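(* Let $\alpha \ge 1$ and consider the branching random walk on the comb $C_2$ with the rates $k_{xy}$ described in the context (depending on $\alpha$) and parameter $\lambda \in (\lambda_w, \lambda_s]$, where $\lambda_w = 1/(\alpha+2)$ and $\lambda_s = 1/(2\sqrt{\alpha+1})$. If $I_1, I_2 \subseteq \mathbb{N} \setminus \{0\}$ are such that $\sum_{i \in I_1} 2^{-i} \ne \sum_{i \in I_2} 2^{-i}$, then $$\mathbf{q}\Big(\cdot, \bigcup_{i \in I_1} V_i\Big) \ne \mathbf{q}\Big(\cdot, \bigcup_{i \in I_2} V_i\Big).$$
   Context: $\mathbb{N}=\{0,1,2,\dots\}$. The comb $C_2$ is the graph with vertex set $\{(x,y) \in \mathbb{Z}^2 : y \ge 0\}$ in which $(x,y)$ and $(x_1,y_1)$ are neighbors if and only if either $x = x_1$ and $|y - y_1| = 1$, or $y = y_1 = 0$ and $|x - x_1| = 1$. Put $y_i := (i,0)$ for $i \in \mathbb{Z}$, $o := y_0$, and let $V_i := \{(i,y) : y \ge 0\}$ be the vertical line from $y_i$. Rates (for fixed real $\alpha \ge 1$): rate $1$ from $(x,0)$ to each of $(x\pm1,0)$; rate $\alpha$ from $(x,0)$ to $(x,1)$; for $y \ge 1$, rate $1$ from $(x,y)$ to $(x,y-1)$ and rate $\alpha+1$ from $(x,y)$ to $(x,y+1)$; all other rates are $0$. Write $k_{vw}$ for the rate from vertex $v$ to vertex $w$. The process. In the continuous-time branching random walk (BRW) with parameter $\lambda > 0$, each particle lives an exponential time of parameter 1 and, while alive, a particle at $v$ gives birth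 to a child at $w$ at the times of an independent Poisson process of rate $\lambda k_{vw}$, for each $w$; all particles behave independently. Its discrete-time counterpart $\{\eta_n\}_{n\in\mathbb{N}}$ is: generation $0$ consists of the initial particles, generation $n+1$ consists of the children of all the particles of generation $n$ (with their positions), and $\eta_n(v)$ is the number of generation-$n$ particles at $v$. Equivalently, it is the discrete-time BRW in which each particle at $v$ is independently replaced by a random finite offspring configuration with generating function $G(\mathbf{z}|v) = \big(1 + \lambda \sum_{w} k_{vw}(1 - \mathbf{z}(w))\big)^{-1}$, $\mathbf{z}\in[0,1]^{C_2}$. $\mathbb{P}^{\delta_v}$ is the law started from one particle at $v$. Critical parameters. $\lambda_w$ (global) is the infimum of the $\lambda > 0$ for which the process survives (is never empty) with positive probability, and $\lambda_s$ (local) is the infimum of the $\lambda > 0$ for which a given vertex is occupied at arbitrarily large times with positive probability. For this BRW $\lambda_w = 1/(\alpha+2)$ and $\lambda_s = 1/(2\sqrt{\alpha+1})$. Extinction probabilities. For $A \subseteq C_2$, $\mathbf{q}(v,A) := 1 - \mathbb{P}^{\delta_v}\big(\limsup_{n \to \infty} \sum_{w \in A} \eta_n(w) > 0\big)$. *)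

(* Defs.v *)
From HB Require Import structures.
From mathcomp Require Import all_boot all_order all_algebra.
From mathcomp Require Import finmap multiset.
From mathcomp Require Import all_classical all_reals all_analysis.

Set Implicit Arguments.
Unset Strict Implicit.
Unset Printing Implicit Defensive.

Import Order.TTheory GRing.Theory Num.Theory.
Import numFieldNormedType.Exports.

Local Open Scope classical_set_scope.
Local Open Scope ring_scope.

(* The second coordinate being a [nat] encodes the constraint y >= 0. *)
Definition comb : Type := (int * nat)%type.

Definition vertical_line (i : int) : set comb := [set v | v.1 = i].

Definition rate (R : realType) (alpha : R) (v w : comb) : R :=
  let: (x, y) := v in
  let: (x1, y1) := w in
  if [&& y == 0%N, y1 == 0%N & `|x - x1| == 1] then 1
  else if (x == x1) && (y1 == y.+1) then
    (if y == 0%N then alpha else alpha + 1)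
  else if (x == x1) && (y == y1.+1) then 1
  else 0.

Definition lambda_w (R : realType) (alpha : R) : R := 1 / (alpha + 2).

Definition lambda_s (R : realType) (alpha : R) : R :=
  1 / (2 * Num.sqrt (alpha + 1)).

(* Finite particle configurations: [eta w] is the number of particles at w. *)
Definition config : Type := {mset comb}%mset.

(* The sum over all w is finite because each vertex has finitely many
   neighbours ([\sum_(w \in A)] only sees the nonzero summands). *)
Definition offspring_gf (R : realType) (alpha lambda : R) (z : comb -> R)
    (v : comb) : R :=
  (1 + lambda * \sum_(w \in [set: comb]) rate alpha v w * (1 - z w))^-1.

Definition config_monomial (R : realType) (z : comb -> R) (f : config) : R :=
  \prod_(w <- finsupp f) z w ^+ f w.

Definition mutually_independent (R : realType) (d : measure_display)
    (Omega : measurableType d) (P : probability Omega R) (I : eqType)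
    (T : Type) (X : I -> Omega -> T) : Prop :=
  forall (s : seq I) (B : I -> set T), uniq s ->
    P (\bigcap_(i in [set` s]) (X i @^-1` B i)) =
    (\prod_(i <- s) P (X i @^-1` B i))%E.

(* [xi (n, v, k)] is the configuration of children of the k-th particle of
   generation n at v.  Configurations form a countable set, equipped with the
   discrete sigma-algebra; a law on it is determined by its generating
   function on [0, 1]^comb. *)
Definition offspring_family (R : realType) (alpha lambda : R)
    (d : measure_display) (Omega : measurableType d)
    (P : probability Omega R)
    (xi : nat * comb * nat -> Omega -> config) : Prop :=
  [/\ (forall i (B : set config), measurable (xi i @^-1` B)),
      mutually_independent P xi
    & forall n v k (z : comb -> R), (forall w, 0 <= z w <= 1) ->
        ('E_P[fun omega => config_monomial z (xi (n, v, k) omega)] =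
         (offspring_gf alpha lambda z v)%:E)%E].

(* Under P, the process [brw xi v] has law P^{delta_v}. *)
Fixpoint brw (Omega : Type) (xi : nat * comb * nat -> Omega -> config)
    (v : comb) (n : nat) (omega : Omega) : config :=
  if n is m.+1 then
    let eta := brw xi v m omega in
    \big[msetD/mset0]_(u <- finsupp eta)
      \big[msetD/mset0]_(k < eta u) xi (m, u, k : nat) omega
  else [mset v]%mset.

Definition population (R : realType) (A : set comb) (eta : config) : R :=
  \sum_(w \in A) ((eta w)%:R : R).

Definition survival_event (R : realType) (Omega : Type)
    (xi : nat * comb * nat -> Omega -> config) (v : comb) (A : set comb) :
    set Omega :=
  [set omega |
    (0 < limn_esup (fun n => (population R A (brw xi v n omega))%:E))%E].

Definition extinction_prob (R : realType) (d : measure_display)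
    (Omega : measurableType d) (P : probability Omega R)
    (xi : nat * comb * nat -> Omega -> config) (A : set comb) (v : comb) : R :=
  1 - fine (P (survival_event R xi v A)).

(* Main.v *)
Require Import Defs.
From HB Require Import structures.
From mathcomp Require Import all_boot all_order all_algebra.
From mathcomp Require Import finmap multiset.
From mathcomp Require Import all_classical all_reals all_analysis.
From mathcomp Require Import measurable_realfun ring lra.

Set Implicit Arguments.
Unset Strict Implicit.
Unset Printing Implicit Defensive.

Import Order.TTheory GRing.Theory Num.Theory.
Import numFieldNormedType.Exports.

Local Open Scope classical_set_scope.
Local Open Scope ring_scope.

(** The two index sets differ, say j lies in I1 and not in I2.  The two
   extinction probabilities are then told apart by starting the walk at (j, y)
   with y large.

   Let G be the operator [offspring_gf].  For z with values in [0, 1] the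
   branching property says that the product of z over the particles of
   generation n + 1 has, given the past, the same mean as the product of G z
   over the particles of generation n ([integral_next_generation]).  Two
   consequences follow.

   If f = 1 on A and G (1 - f) >= 1 - f, then the product of 1 - f over the
   population is a submartingale that vanishes as soon as A is occupied;
   stopping it there gives P(A is ever occupied) <= f v ([survival_le]).

   If h = 0 off A and G (1 - h) <= 1 - h, then the product of 1 - h is a
   supermartingale that equals 1 whenever A is empty, so that
   P(A is occupied at time n) >= h v for every n, and A is occupied infinitely
   often with probability at least h v ([survival_ge]).

   On the line V_j put s = 1 / sqrt (alpha + 1), the point where
   1 / s + (alpha + 1) s takes its minimal value 2 sqrt (alpha + 1).  The bound
   lambda <= lambda_s says exactly that lambda (1 / s + (alpha + 1) s) <= 1, so
   y |-> s ^ y is superharmonic for the mean offspring operator on V_j.  Since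
   s < 1 this makes f (j, y) = s ^ y, extended by 1 off V_j, a bound on the
   probability of ever leaving V_j, hence of ever visiting the lines of I2
   ([exit_bound_gf]).  The bound lambda > lambda_w says that the total mean
   offspring m = lambda (alpha + 2) of a vertex off the base exceeds 1; with
   c = 1 - 1 / m, the function h (j, y) = c (1 - s ^ y), extended by 0 off V_j,
   satisfies the second condition ([stay_bound_gf]).  As y grows, f (j, y) tends
   to 0 and h (j, y) to c > 0, so for large y the lines of I1 survive with
   strictly larger probability than those of I2. *)

(** * Random variables with countably many values *)

Section CountablePartition.
Context (d : measure_display) (Omega : measurableType d) (T : countType).
Variable Y : Omega -> T.

(** Fibers are numbered by the code of the value, so that an event splits along
   Y into a sequence, the shape that countable additivity expects; numbers
   that code no value of Y give empty fibers. *)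
Definition fiber (k : nat) : set Omega := [set w | choice.pickle (Y w) = k].

Lemma fiber_cases k :
  fiber k = set0 \/ exists w0, fiber k = [set w | Y w = Y w0].
Proof.
have [->|/set0P[w0 <-]] := eqVneq (fiber k) set0; first by left.
right; exists w0; apply/seteqP; split=> w /=; rewrite /fiber /=.
  by move=> /(pcan_inj choice.pickleK).
by move=> ->.
Qed.

Lemma trivIset_fiber (B : set Omega) : trivIset setT (fun k => B `&` fiber k).
Proof.
apply/trivIsetP => i j _ _ /eqP ij; apply/seteqP; split=> // w [[_ wi] [_ wj]].
by apply: ij; rewrite -wi -wj.
Qed.

Lemma bigcup_fiber (B : set Omega) : B = \bigcup_k (B `&` fiber k).
Proof.
apply/seteqP; split=> [w Bw|w [k _ []]//].
by exists (choice.pickle (Y w)).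
Qed.

Hypothesis mY : forall w0, measurable [set w | Y w = Y w0].

Lemma measurable_fiber k : measurable (fiber k).
Proof. by have [->|[w0 ->]] := fiber_cases k. Qed.

Lemma measurable_discrete (Q : set T) : measurable (Y @^-1` Q).
Proof.
rewrite (bigcup_fiber (Y @^-1` Q)); apply: bigcup_measurable => k _.
have [->|[w0 E]] := fiber_cases k; first by rewrite setI0.
have [Qw|nQw] := pselect (Q (Y w0)).
  rewrite setIidr ?E // => w /= ->; exact: Qw.
rewrite (_ : _ `&` _ = set0) //; apply/seteqP; split=> // w [/= Qw].
by rewrite E /= => Yw; apply: nQw; rewrite -Yw.
Qed.

Lemma measurable_fun_discrete d' (T' : measurableType d') (g : T -> T') :
  measurable_fun setT (g \o Y).
Proof.
move=> _ U mU; rewrite setTI.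
exact: (measurable_discrete (g @^-1` U)).
Qed.

Lemma integral_fibers (R : realType) (P : probability Omega R) (B : set Omega)
    (f : Omega -> \bar R) :
  measurable B -> measurable_fun B f -> (forall w, B w -> 0 <= f w)%E ->
  (\int[P]_(w in B) f w = \sum_(k <oo) \int[P]_(w in B `&` fiber k) f w)%E.
Proof.
move=> mB mf f0; rewrite {1}(bigcup_fiber B) ge0_integral_bigcup //=.
- by move=> k; apply: measurableI => //; exact: measurable_fiber.
- by rewrite -bigcup_fiber.
- by rewrite -bigcup_fiber.
- exact: trivIset_fiber.
Qed.

Lemma measure_fibers (R : realType) (P : probability Omega R) (B : set Omega) :
  measurable B -> (P B = \sum_(k <oo) P (B `&` fiber k))%E.
Proof.
move=> mB; rewrite {1}(bigcup_fiber B) measure_bigcup //.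
- by apply: eq_eseriesl => k; exact: mem_set.
- by move=> k _; apply: measurableI => //; exact: measurable_fiber.
- exact: trivIset_fiber.
Qed.

End CountablePartition.

(** * Independence of events determined by finitely many variables *)

Section Independence.
Context (R : realType) (d : measure_display) (Omega : measurableType d).
Context (P : probability Omega R) (I : eqType) (T : countType).
Variable X : I -> Omega -> T.

(** Measurability with respect to the variables indexed by s, phrased pointwise
   because they take countably many values. *)
Definition determined_by (s : seq I) (B : set Omega) :=
  forall w w', {in s, forall i, X i w = X i w'} -> B w -> B w'.

Hypothesis mX : forall i (C : set T), measurable (X i @^-1` C).
Hypothesis indepX : mutually_independent P X.

Definition profile (s : seq I) (w : Omega) : seq T := [seq X i w | i <- s].

Lemma profile_atom s w0 :
  [set w | profile s w = profile s w0] =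
  \bigcap_(i in [set` s]) (X i @^-1` [set X i w0]).
Proof.
apply/seteqP; split=> w /=.
  by move=> /eq_in_map h i /= /h.
by move=> h; apply/eq_in_map => i si; apply: h.
Qed.

Lemma measurable_profile_atom s w0 :
  measurable [set w | profile s w = profile s w0].
Proof.
by rewrite profile_atom; apply: fin_bigcap_measurable => // i _; exact: mX.
Qed.

Lemma determined_profile s B : determined_by s B ->
  B = profile s @^-1` (profile s @` B).
Proof.
move=> sB; apply/seteqP; split=> [w Bw|w [w' Bw' /eq_in_map h]].
  by exists w.
exact: (sB w' w).
Qed.

Lemma measurable_determined s B : determined_by s B -> measurable B.
Proof.
move=> /determined_profile ->; apply: measurable_discrete.
exact: measurable_profile_atom.
Qed.

(** An atom of the profile is a rectangle, so the product rule for rectangles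
   applies to it, once repeated indices are dropped. *)
Lemma indep_profile s w0 i (C : set T) : i \notin s ->
  (P ([set w | profile s w = profile s w0] `&` X i @^-1` C) =
   P [set w | profile s w = profile s w0] * P (X i @^-1` C))%E.
Proof.
move=> si.
have atomE : [set w | profile s w = profile s w0] =
    \bigcap_(j in [set` undup s]) (X j @^-1` [set X j w0]).
  rewrite profile_atom; congr bigcap; apply/seteqP; split=> j /=;
  by rewrite mem_undup.
rewrite atomE indepX ?undup_uniq // muleC.
(* The joint event is again a rectangle, with C added as the side at i. *)
pose D j := if j == i then C else [set X j w0].
have -> : \bigcap_(j in [set` undup s]) (X j @^-1` [set X j w0]) `&` X i @^-1` C
    = \bigcap_(j in [set` i :: undup s]) (X j @^-1` D j).
  apply/seteqP; split=> w /=.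
    move=> [h Ci] j /=; rewrite inE /D; case: eqVneq => [->//|_ /=].
    exact: h.
  move=> h; split; last first.
    by have := h i; rewrite /D /= eqxx; apply; rewrite mem_head.
  move=> j /= sj; have := h j; rewrite /= inE sj orbT => /(_ isT).
  by rewrite /D; case: eqVneq => // ji; move: si; rewrite -ji -mem_undup sj.
rewrite indepX /= ?mem_undup ?si ?undup_uniq // big_cons {1}/D eqxx.
congr (_ * _)%E; rewrite !big_seq; apply: eq_bigr => j sj; rewrite /D.
by case: eqVneq => // ji; move: si; rewrite -ji -mem_undup sj.
Qed.

(** An event determined by s is a countable disjoint union of atoms of the
   profile of s, each of which is independent of the variable at i. *)
Lemma indep_determined s B i (C : set T) : determined_by s B -> i \notin s ->
  (P (B `&` X i @^-1` C) = P B * P (X i @^-1` C))%E.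
Proof.
move=> sB si; have mB := measurable_determined sB.
have mat := measurable_profile_atom s.
rewrite (measure_fibers mat); last exact: measurableI.
rewrite (measure_fibers mat P mB) [RHS]muleC.
rewrite -(@fineK _ (P (X i @^-1` C))) ?fin_num_measure //.
rewrite -nneseriesZl // fineK ?fin_num_measure //.
apply: eq_eseriesr => k _.
have [->|[w0 kE]] := fiber_cases (profile s) k.
  by rewrite !setI0 !measure0 mule0.
have [Bw|nBw] := pselect (B w0).
  have sub : fiber (profile s) k `<=` B.
    move=> w; rewrite kE /= => /esym/eq_in_map h; exact: (sB w0).
  rewrite setIAC (setIidr sub) kE indep_profile // muleC //.
have E : B `&` fiber (profile s) k = set0.
  apply/seteqP; split=> // w [Bw]; rewrite kE /= => /eq_in_map h.
  by apply: nBw; apply: (sB w).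
by rewrite setIAC E set0I measure0 mule0.
Qed.

(** The factors are integrated out one at a time: splitting along the value of
   the first variable freezes its factor, and the event it is frozen on is
   determined by one more index.  This is why the lemma allows a conditioning
   event B. *)
Lemma indep_integral_prod (f : I -> T -> R) (g : I -> R) (t s : seq I) B :
  (forall i x, 0 <= f i x) ->
  (forall i, \int[P]_w (f i (X i w))%:E = (g i)%:E)%E ->
  uniq t -> {in t, forall i, i \notin s} -> determined_by s B ->
  (\int[P]_(w in B) (\prod_(i <- t) f i (X i w))%:E =
   (\prod_(i <- t) g i)%:E * P B)%E.
Proof.
move=> f0 fg.
have mf t' : measurable_fun setT
    (fun w => (\prod_(i <- t') f i (X i w))%:E : \bar R).
  apply/measurable_EFinP; apply: measurable_prod => i _.
  apply: (@measurable_fun_discrete _ _ _ (X i)) => w0.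
  exact: (mX i [set X i w0]).
have f0' t' w : (0%R <= (\prod_(i <- t') f i (X i w))%:E :> \bar R)%E.
  by rewrite lee_fin prodr_ge0.
elim: t s B => [|i t IH] s B /=.
  move=> _ _ sB; rewrite big_nil mul1e.
  under eq_integral do rewrite big_nil.
  by rewrite integral_cst ?mul1e //; exact: (measurable_determined sB).
move=> /andP[it ut] ts sB; have mB := measurable_determined sB.
have finE (A : set Omega) : measurable A -> exists p : R, P A = p%:E.
  by move=> mA; exists (fine (P A)); rewrite fineK // fin_num_measure.
have [p pE] := finE B mB.
have mat w0 : measurable [set w | X i w = X i w0] by exact: (mX i [set X i w0]).
rewrite (integral_fibers mat) //; last exact: measurable_funTS.
have fibE k : (\int[P]_(w in B `&` fiber (X i) k)
      (\prod_(j <- i :: t) f j (X j w))%:E =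
    ((\prod_(j <- t) g j) * p)%:E *
      \int[P]_(w in fiber (X i) k) (f i (X i w))%:E)%E.
  have [->|[w0 kE]] := fiber_cases (X i) k.
    by rewrite setI0 !integral_set0 mule0.
  rewrite kE.
  have dB : determined_by (i :: s) (B `&` [set w | X i w = X i w0]).
    move=> w w' h [Bw /= iw]; split=> /=.
      by apply: (sB w) => // j js; apply: h; rewrite inE js orbT.
    by rewrite -iw; apply/esym/h; rewrite mem_head.
  under eq_integral => w.
    rewrite inE => -[_ /= iw]; rewrite big_cons iw EFinM; over.
  rewrite ge0_integralZl //=; last 3 first.
  - exact: measurable_determined dB.
  - exact: measurable_funTS.
  - by rewrite lee_fin.
  rewrite (IH _ _ ut _ dB); last first.
    move=> j jt; rewrite inE negb_or ts ?inE ?jt ?orbT // andbT.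
    by apply: contraNneq it => <-.
  rewrite (indep_determined [set X i w0] sB) ?ts ?mem_head //.
  under [in RHS]eq_integral => w do [rewrite inE => /= iw; rewrite iw].
  rewrite integral_cst //.
  have [q qE] := finE _ (mX i [set X i w0]).
  transitivity ((\prod_(j <- t) g j * p)%:E * ((f i (X i w0))%:E * q%:E))%E.
    by rewrite pE qE -!EFinM; congr EFin; ring.
  by congr (_ * (_ * _))%E.
under eq_eseriesr do rewrite fibE.
rewrite nneseriesZl; last first.
  by move=> k _; apply: integral_ge0 => w _; rewrite lee_fin.
have <- : (\int[P]_w (f i (X i w))%:E =
    \sum_(k <oo) \int[P]_(w in fiber (X i) k) (f i (X i w))%:E)%E.
  rewrite (integral_fibers mat) //; last 2 first.
  - by have := mf [:: i]; under eq_fun do rewrite big_seq1.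
  - by move=> w _; rewrite lee_fin.
  by under eq_eseriesr do rewrite setTI.
rewrite fg big_cons pE -!EFinM /=; congr EFin; ring.
Qed.

End Independence.

(** * Monomials of configurations *)

Section Monomial.
Context (R : realType).
Implicit Types (z : comb -> R) (A B : config).

Lemma config_monomial_sub z A (S : {fset comb}) : (finsupp A `<=` S)%fset ->
  config_monomial z A = \prod_(w <- S) z w ^+ A w.
Proof.
by move=> AS; apply: big_fset_incl => // w _ /fsfun_dflt ->; rewrite expr0.
Qed.

Lemma config_monomial0 z : config_monomial z mset0%mset = 1.
Proof. by rewrite /config_monomial finsupp0 big_seq_fset0. Qed.

Lemma config_monomial1 z v : config_monomial z [mset v]%mset = z v.
Proof.
rewrite /config_monomial finsupp_msetn /= big_seq_fset1.
by rewrite msetnxx expr1.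
Qed.

Lemma config_monomialD z :
  {morph config_monomial z : A B / (A `+` B)%mset >-> A * B}.
Proof.
move=> A B /=.
rewrite (@config_monomial_sub z A (finsupp A `|` finsupp B)%fset) ?fsubsetUl //.
rewrite (@config_monomial_sub z B (finsupp A `|` finsupp B)%fset) ?fsubsetUr //.
rewrite (@config_monomial_sub z (A `+` B)%mset (finsupp A `|` finsupp B)%fset).
  by rewrite -big_split /=; apply: eq_bigr => w _; rewrite msetE2 exprD.
by apply/fsubsetP => w; rewrite inE !msuppE in_msetD.
Qed.

Lemma config_monomial_ge0 z A :
  (forall w, 0 <= z w) -> 0 <= config_monomial z A.
Proof. by move=> z0; apply: prodr_ge0 => w _; exact: exprn_ge0. Qed.

Lemma le_config_monomial z z' A : (forall w, 0 <= z w <= z' w) ->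
  config_monomial z A <= config_monomial z' A.
Proof.
move=> zz'; apply: ler_prod => w _; have /andP[z0 z1] := zz' w.
by rewrite exprn_ge0 //= lerXn2r ?nnegrE // (le_trans z0).
Qed.

Lemma config_monomial_eq0 z A w :
  z w = 0 -> A w != 0%N -> config_monomial z A = 0.
Proof.
move=> zw Aw; apply/eqP; rewrite /config_monomial prodf_seq_eq0.
apply/hasP; exists w; first by rewrite msuppE -mset_neq0.
by rewrite /= zw expr0n (negbTE Aw).
Qed.

Lemma config_monomial_eq1 z A : (forall w, A w != 0%N -> z w = 1) ->
  config_monomial z A = 1.
Proof.
move=> z1; rewrite /config_monomial big_seq big1 // => w.
by rewrite msuppE -mset_neq0 => /z1 ->; rewrite expr1n.
Qed.

Lemma config_monomial_le1 z A :
  (forall w, 0 <= z w <= 1) -> config_monomial z A <= 1.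
Proof.
move=> z01; rewrite -(@config_monomial_eq1 (fun=> 1) A) //.
exact: le_config_monomial.
Qed.

End Monomial.

(** * The branching property *)

(** The offspring variables that are read to pass from generation n, in state
   eta, to generation n + 1. *)
Definition child_slots (n : nat) (eta : config) : seq (nat * comb * nat) :=
  [seq (n, u, k) | u <- finsupp eta, k <- iota 0 (eta u)].

Lemma child_slots_uniq n eta : uniq (child_slots n eta).
Proof.
apply: allpairs_uniq_dep => [|u _|]; first exact: fset_uniq.
  exact: iota_uniq.
by move=> [u k] [u' k'] /= _ _ [-> ->].
Qed.

Lemma big_child_slots (S : Type) (idx : S) (op : Monoid.com_law idx)
    (F : nat * comb * nat -> S) n (eta : config) :
  \big[op/idx]_(i <- child_slots n eta) F i =
  \big[op/idx]_(u <- finsupp eta) \big[op/idx]_(k < eta u) F (n, u, k : nat).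
Proof.
rewrite big_allpairs_dep; apply: eq_bigr => u _.
(* [index_iota 0 n] is [iota 0 (n - 0)]. *)
by rewrite -[X in iota 0 X]subn0 -/(index_iota _ _) big_mkord.
Qed.

Section BranchingWalk.
Context (R : realType) (alpha lambda : R) (d : measure_display).
Context (Omega : measurableType d) (P : probability Omega R).
Variables (xi : nat * comb * nat -> Omega -> config) (v : comb).
Hypothesis xiP : offspring_family alpha lambda P xi.

Local Notation eta n := (brw xi v n).
Local Notation G := (offspring_gf alpha lambda).

Definition history (n : nat) (w : Omega) : seq config :=
  [seq eta m w | m <- iota 0 n.+1].

Lemma history_eq n w w' :
  history n w = history n w' <-> forall m, (m <= n)%N -> eta m w = eta m w'.
Proof.
split=> [/eq_in_map h m mn|h]; first by apply: h; rewrite mem_iota.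
by apply/eq_in_map => m; rewrite mem_iota /= add0n ltnS => /h.
Qed.

Lemma brw_eq_next n w w' : eta n w = eta n w' ->
  {in child_slots n (eta n w), forall i, xi i w = xi i w'} ->
  eta n.+1 w = eta n.+1 w'.
Proof.
move=> nE h /=; rewrite -nE big_seq [RHS]big_seq; apply: eq_bigr => u uS.
apply: eq_bigr => k _; apply: h; apply/allpairsPdep; exists u, (k : nat).
by split => //; rewrite mem_iota /=.
Qed.

(** A priori the history up to time n reads infinitely many offspring variables,
   but once its value is fixed it reads only those of the particles listed in
   it, all of generations before n. *)
Lemma history_determined n w0 : exists s : seq (nat * comb * nat),
  (forall i, i \in s -> (i.1.1 < n)%N) /\
  determined_by xi s [set w | history n w = history n w0].
Proof.
elim: n => [|n [s [sn sD]]].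
  by exists [::]; split => // w w' _ _; apply/history_eq => -[].
exists (s ++ child_slots n (eta n w0)); split.
  move=> i; rewrite mem_cat => /orP[/sn /leqW//|].
  by move=> /allpairsPdep[u [k [_ _ ->]]] /=.
move=> w w' ww' /= /history_eq wE; apply/history_eq => m.
have w'E : history n w' = history n w0.
  apply: (sD w) => /=; first by move=> i si; apply: ww'; rewrite mem_cat si.
  by apply/history_eq => k kn; apply: wE; exact: leqW.
rewrite leq_eqVlt => /orP[/eqP ->|mn]; last exact: ((history_eq n w' w0).1 w'E).
have nE : eta n w = eta n w0 by exact: wE.
rewrite -wE //; apply/esym/brw_eq_next.
  by rewrite nE; apply/esym/((history_eq n w' w0).1 w'E).
by rewrite nE => i iS; apply: ww'; rewrite mem_cat iS orbT.
Qed.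

Let mxi i (C : set config) : measurable (xi i @^-1` C).
Proof. by case: xiP. Qed.

Let indep_xi : mutually_independent P xi. Proof. by case: xiP. Qed.

Lemma measurable_history_atom n w0 :
  measurable [set w | history n w = history n w0].
Proof.
have [s [_ sD]] := history_determined n w0.
exact: (measurable_determined mxi sD).
Qed.

Lemma measurable_brw n (Q : set config) : measurable (eta n @^-1` Q).
Proof.
have -> : eta n = (last mset0%mset) \o history n.
  apply/funext => w; rewrite -[RHS]nth_last size_map size_iota.
  by rewrite (nth_map 0%N) ?size_iota // nth_iota.
exact: (measurable_discrete (measurable_history_atom n) (_ @^-1` Q)).
Qed.

Lemma measurable_monomial z n (D : set Omega) :
  measurable_fun D (fun w => (config_monomial z (eta n w))%:E : \bar R).
Proof.
apply: measurable_funTS; apply/measurable_EFinP.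
apply: (@measurable_fun_discrete _ _ _ (eta n)) => w0.
exact: (measurable_brw n [set eta n w0]).
Qed.

Definition stays (Q : set config) (n : nat) : set Omega :=
  [set w | forall m, (m <= n)%N -> Q (eta m w)].

Lemma measurable_stays Q n : measurable (stays Q n).
Proof.
have -> : stays Q n = \bigcap_(m in `I_n.+1) (eta m @^-1` Q).
  by apply/seteqP; split=> w /= h m; have := h m; rewrite /= ltnS.
apply: fin_bigcap_measurable => // m _; exact: measurable_brw.
Qed.

(** The branching property.  On each history the next monomial is a finite
   product of functions of fresh offspring variables, which are independent of
   that history. *)
Lemma integral_next_generation z Q n : (forall w, 0 <= z w <= 1) ->
  (\int[P]_(w in stays Q n) (config_monomial z (eta n.+1 w))%:E =
   \int[P]_(w in stays Q n) (config_monomial (G z) (eta n w))%:E)%E.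
Proof.
move=> z01.
have z0 w : 0 <= z w by have /andP[] := z01 w.
have gfE i : (\int[P]_w (config_monomial z (xi i w))%:E = (G z i.1.2)%:E)%E.
  case: xiP => _ _ /(_ i.1.1 i.1.2 i.2 z z01).
  by rewrite unlock; case: i => [[]].
have G0 u : 0 <= G z u.
  rewrite -lee_fin -(gfE (0%N, u, 0%N)); apply: integral_ge0 => w _.
  by rewrite lee_fin config_monomial_ge0.
have mat := measurable_history_atom n.
rewrite (integral_fibers mat); first last.
- by move=> w _; rewrite lee_fin config_monomial_ge0.
- exact: measurable_monomial.
- exact: measurable_stays.
rewrite (integral_fibers mat); first last.
- by move=> w _; rewrite lee_fin config_monomial_ge0.
- exact: measurable_monomial.
- exact: measurable_stays.
apply: eq_eseriesr => k _.
have [->|[w0 kE]] := fiber_cases (history n) k.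
  by rewrite setI0 !integral_set0.
rewrite kE; have [w0Q|w0Q] := pselect (stays Q n w0); last first.
  rewrite (_ : _ `&` _ = set0) ?integral_set0 //.
  apply/seteqP; split=> // w [wQ /= /history_eq wE]; apply: w0Q => m mn.
  by rewrite -wE //; exact: wQ.
rewrite setIidr; last first.
  by move=> w /= /history_eq wE m mn; rewrite wE //; exact: w0Q.
have [s [sn sD]] := history_determined n w0.
pose t := child_slots n (eta n w0).
transitivity (\int[P]_(w in [set w | history n w = history n w0])
    (\prod_(i <- t) config_monomial z (xi i w))%:E)%E.
  apply: eq_integral => w; rewrite inE /= => /history_eq wE.
  rewrite big_child_slots wE //; congr EFin.
  rewrite (big_morph _ (config_monomialD z) (config_monomial0 z)).
  apply: eq_bigr => u _.
  by rewrite (big_morph _ (config_monomialD z) (config_monomial0 z)).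
rewrite (@indep_integral_prod _ _ _ _ _ _ _ mxi indep_xi
   (fun=> config_monomial z) (fun i => G z i.1.2) t s) //; last 3 first.
- by move=> _ A; exact: config_monomial_ge0.
- exact: child_slots_uniq.
- move=> i /allpairsPdep[u [j [_ _ ->]]]; apply/negP => /sn /=.
  by rewrite ltnn.
under [RHS]eq_integral => w.
  rewrite inE /= => /history_eq wE; rewrite wE //; over.
rewrite integral_cst //; congr (_%:E * _)%E.
rewrite big_child_slots /config_monomial; apply: eq_bigr => u _.
by rewrite /= prodr_const card_ord.
Qed.

End BranchingWalk.

(** * Local survival as a limsup of events *)

Definition empty_on (A : set comb) : set config :=
  [set eta | forall w, A w -> eta w = 0%N].

Lemma population_empty (R : realType) A eta :
  empty_on A eta -> population R A eta = 0.
Proof. by move=> h; apply: fsbig1 => w Aw; rewrite h. Qed.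

Lemma population_ge1 (R : realType) A eta :
  ~ empty_on A eta -> 1 <= population R A eta.
Proof.
move=> /existsNP[w /not_implyP[Aw /eqP wN0]].
rewrite /population fsbig_mkcond (fsbigTE (finsupp eta)); last first.
  by move=> u /fsfun_dflt uE; rewrite /patch uE; case: ifP.
rewrite (big_fsetD1 w) /=; last by rewrite msuppE -mset_neq0.
rewrite {1}/patch mem_set // ler_wpDr //.
  by apply: sumr_ge0 => u _; rewrite /patch; case: ifP.
by rewrite ler1n lt0n.
Qed.

(** The gap between 0 and 1 in the values keeps the limsup positive unless the
   sequence vanishes eventually. *)
Lemma limn_esup_gt0 (R : realType) (u : nat -> R) :
  (forall n, u n = 0 \/ 1 <= u n) ->
  (0 < limn_esup (fun n => (u n)%:E))%E <->
  forall n, exists2 m, (n <= m)%N & u m != 0.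
Proof.
move=> u01; split=> [|h].
  apply: contraPP => /existsNP[n /forall2NP nh]; apply/negP; rewrite -leNgt.
  apply: (@le_trans _ _ (ereal_sup [set (u k)%:E | k in [set k | (n <= k)%N]])).
    apply: ereal_inf_lbound; exists [set k | (n <= k)%N] => //.
    by exists n.
  apply: ge_ereal_sup => _ [k /= nk <-].
  by have [//|/negP] := nh k; rewrite negbK => /eqP ->.
apply: (@lt_le_trans _ _ 1%E); first exact: lte01.
apply: le_ereal_inf_tmp => _ [V [n _ nV] <-].
have [m nm um] := h n; apply: (@le_trans _ _ (u m)%:E); last first.
  by apply: ereal_sup_ubound; exists m => //; exact: nV.
by rewrite lee_fin; case: (u01 m) => // u0; rewrite u0 eqxx in um.
Qed.

Section MeasureLimits.
Context (R : realType) (d : measure_display) (Omega : measurableType d).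
Context (P : probability Omega R) (F : nat -> set Omega) (a : \bar R).
Hypothesis mF : forall n, measurable (F n).

Lemma measure_lim_sup_set_ge :
  (forall n, a <= P (F n))%E -> (a <= P (lim_sup_set F))%E.
Proof.
move=> aF.
have mT : measurable (\bigcup_(k in [set k | (0 <= k)%N]) F k).
  exact: bigcup_measurable.
have cF := lim_sup_set_cvg P F mF (le_lt_trans (probability_le1 P mT) (ltry 1)).
rewrite -(cvg_lim _ cF) //; apply: lime_ge; first exact: cvgP cF.
apply: nearW => n; apply: (le_trans (aF n)); apply: le_measure; rewrite ?inE //.
  by apply: bigcup_measurable => k _; exact: mF.
by move=> w Fw; exists n => //=.
Qed.

Lemma measure_bigcup_le : {homo F : m n / (m <= n)%N >-> m `<=` n} ->
  (forall n, P (F n) <= a)%E -> (P (\bigcup_n F n) <= a)%E.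
Proof.
move=> Fnd Fa.
have cF : P \o F @ \oo --> P (\bigcup_n F n).
  apply: nondecreasing_cvg_mu => //; first exact: bigcup_measurable.
  by move=> m n mn; apply/subsetPset; exact: Fnd.
rewrite -(cvg_lim _ cF) //; apply: lime_le; first exact: cvgP cF.
exact: nearW.
Qed.

End MeasureLimits.

(** * Bounds on survival from super- and subsolutions *)

Section Survival.
Context (R : realType) (alpha lambda : R) (d : measure_display).
Context (Omega : measurableType d) (P : probability Omega R).
Variables (xi : nat * comb * nat -> Omega -> config) (v : comb).
Hypothesis xiP : offspring_family alpha lambda P xi.

Local Notation eta n := (brw xi v n).
Local Notation G := (offspring_gf alpha lambda).

Lemma survival_eventE (A : set comb) : survival_event R xi v A =
  lim_sup_set (fun n => eta n @^-1` (~` empty_on A)).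
Proof.
have popN0 e : population R A e != 0 <-> ~ empty_on A e.
  split=> [/eqP pN0 /(population_empty R) //|/(population_ge1 R) p1].
  by apply: contraTneq p1 => ->; rewrite ler10.
have pop01 w n : population R A (eta n w) = 0 \/ 1 <= population R A (eta n w).
  have [/(population_empty R)|/(population_ge1 R)] :=
    pselect (empty_on A (eta n w)); first by left.
  by right.
apply/seteqP; split=> w; rewrite /survival_event /=.
  rewrite (limn_esup_gt0 (pop01 w)) => h n _.
  by have [m nm /popN0] := h n; exists m.
move=> h; apply/(limn_esup_gt0 (pop01 w)) => n.
by have [m nm /popN0] := h n I; exists m.
Qed.

Lemma measurable_survival A : measurable (survival_event R xi v A).
Proof.
rewrite survival_eventE; apply: bigcap_measurable => // n _.
apply: bigcup_measurable => m _; exact: measurable_brw xiP _ _.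
Qed.

(** The monomial of 1 - h is a supermartingale which equals 1 on the event that
   A is empty at time n.  This bounds each one-time probability; the bound passes
   to the limsup by continuity from above. *)
Lemma survival_ge (A : set comb) (h : comb -> R) :
  (forall w, 0 <= h w <= 1) -> (forall w, ~ A w -> h w = 0) ->
  (forall w, 0 <= G (fun u => 1 - h u) w <= 1 - h w) ->
  ((h v)%:E <= P (survival_event R xi v A))%E.
Proof.
move=> h01 hA Gh; pose z u := 1 - h u.
have z01 w : 0 <= z w <= 1.
  by rewrite /z; have := h01 w; lra.
have z0 w : 0 <= z w by have /andP[] := z01 w.
have Ez n : (\int[P]_w (config_monomial z (eta n w))%:E <= (z v)%:E)%E.
  elim: n => [|n IH].
    under eq_integral => w _ do rewrite /= config_monomial1.
    by rewrite integral_cst //= probability_setT mule1.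
  apply: le_trans IH.
  have := integral_next_generation v xiP setT n z01.
  have -> : stays xi v setT n = setT by apply/seteqP; split.
  move=> ->; apply: ge0_le_integral => //.
  - move=> w _; rewrite lee_fin config_monomial_ge0 // => u.
    by have /andP[] := Gh u.
  - exact: measurable_monomial xiP _ _ _.
  - exact: measurable_monomial xiP _ _ _.
  - by move=> w _; rewrite lee_fin; exact: le_config_monomial.
have Pn n : ((h v)%:E <= P (eta n @^-1` (~` empty_on A)))%E.
  have mE : measurable (eta n @^-1` empty_on A).
    exact: measurable_brw xiP _ _.
  rewrite preimage_setC probability_setC // leeBrDr ?fin_num_measure //.
  rewrite -leeBrDl // -EFinB -/(z v).
  apply: le_trans (Ez n).
  rewrite -[leLHS]mul1e -integral_cst // [leLHS]integral_mkcond.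
  apply: ge0_le_integral => //.
  - by move=> w _; apply: erestrict_ge0 => ? _; rewrite lee_fin.
  - by apply/(measurable_restrictT _ _).1 => //; exact: measurable_cst.
  - exact: measurable_monomial xiP _ _ _.
  - move=> w _; rewrite /patch; case: ifPn; rewrite ?inE => wA; last first.
      by rewrite lee_fin config_monomial_ge0.
    rewrite config_monomial_eq1 // => u /eqP uN0.
    by rewrite /z hA ?subr0 // => /wA.
have mn n : measurable (eta n @^-1` (~` empty_on A)).
  exact: measurable_brw xiP _ _.
rewrite survival_eventE; exact: measure_lim_sup_set_ge.
Qed.

(** The monomial of 1 - f is a submartingale which vanishes whenever A is
   occupied, so restricting its integral to the paths that have avoided A so far
   costs nothing: that integral is nondecreasing in n, starts at 1 - f v, and is
   at most the probability of having avoided A up to time n. *)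
Lemma survival_le (A : set comb) (f : comb -> R) :
  (forall w, 0 <= f w <= 1) -> (forall w, A w -> f w = 1) ->
  (forall w, 1 - f w <= G (fun u => 1 - f u) w) ->
  (P (survival_event R xi v A) <= (f v)%:E)%E.
Proof.
move=> f01 fA Gf; pose z u := 1 - f u.
have z01 w : 0 <= z w <= 1.
  by rewrite /z; have := f01 w; lra.
have z0 w : 0 <= z w by have /andP[] := z01 w.
have Gz0 w : 0 <= G z w by exact: le_trans (z0 w) (Gf w).
have hit n w : ~ empty_on A (eta n w) -> config_monomial z (eta n w) = 0.
  move=> /existsNP[u /not_implyP[Au /eqP uN0]].
  by rewrite (@config_monomial_eq0 _ _ _ u) // /z fA // subrr.
have mz n D :
    measurable_fun D (fun w => (config_monomial z (eta n w))%:E : \bar R).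
  exact: measurable_monomial xiP _ _ _.
have mS n : measurable (stays xi v (empty_on A) n).
  exact: measurable_stays xiP _ _.
have Ez n : ((z v)%:E <= \int[P]_(w in stays xi v (empty_on A) n)
    (config_monomial z (eta n w))%:E)%E.
  elim: n => [|n IH].
    have [vA|vA] := pselect (A v).
      rewrite /z fA // subrr; apply: integral_ge0 => w _.
      by rewrite lee_fin config_monomial_ge0.
    have -> : stays xi v (empty_on A) 0 = setT.
      apply/seteqP; split => // w _ m; rewrite leqn0 => /eqP -> u Au /=.
      by rewrite msetnE; case: eqP => // uv; case: vA; rewrite -uv.
    under eq_integral => w _ do rewrite /= config_monomial1.
    by rewrite integral_cst //= probability_setT mule1.
  apply: (le_trans IH).
  (* The two domains differ only by paths that occupy A at time n + 1. *)
  have -> : (\int[P]_(w in stays xi v (empty_on A) n.+1)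
                (config_monomial z (eta n.+1 w))%:E =
             \int[P]_(w in stays xi v (empty_on A) n)
                (config_monomial z (eta n.+1 w))%:E)%E.
    rewrite integral_mkcond [RHS]integral_mkcond; apply: eq_integral => w _.
    rewrite /patch; case: ifPn => [|]; rewrite ?inE => wn1.
      by rewrite mem_set // => m mn; apply: wn1; exact: leqW.
    case: ifPn => //; rewrite inE => wn.
    rewrite hit // => eta_empty; case/negP: wn1; rewrite inE => m.
    by rewrite leq_eqVlt => /orP[/eqP -> //|]; exact: wn.
  rewrite (integral_next_generation v xiP _ _ z01).
  apply: ge0_le_integral => //.
  - by move=> w _; rewrite lee_fin config_monomial_ge0.
  - exact: measurable_monomial xiP _ _ _.
  - move=> w _; rewrite lee_fin; apply: le_config_monomial => u.
    by rewrite z0 Gf.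
have Pn n : ((z v)%:E <= P (stays xi v (empty_on A) n))%E.
  apply: (le_trans (Ez n)).
  rewrite -[leRHS]mul1e -integral_cst //.
  apply: ge0_le_integral => //.
  - by move=> w _; rewrite lee_fin config_monomial_ge0.
  - by move=> w _; rewrite lee_fin; exact: config_monomial_le1.
have mC n : measurable (~` stays xi v (empty_on A) n) by exact: measurableC.
apply: (@le_trans _ _ (P (\bigcup_n ~` stays xi v (empty_on A) n))).
  apply: le_measure; rewrite ?inE.
  - exact: measurable_survival.
  - exact: bigcup_measurable.
  - rewrite survival_eventE => w /(_ 0%N I)[n _ nw].
    by exists n => // wS; apply: nw; exact: wS.
apply: measure_bigcup_le => // [m n mn|n].
  by apply: subsetC => w wS k km; apply: wS; exact: leq_trans mn.
rewrite probability_setC // leeBlDr ?fin_num_measure // -leeBlDl // -EFinB.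
Qed.

End Survival.

(** * Explicit super- and subsolutions on a tooth of the comb *)

Section CombEstimates.
Context (R : realType) (alpha lambda : R).

Local Notation G := (offspring_gf alpha lambda).

Lemma offspring_gf_bounds z v : 0 <= alpha -> 0 <= lambda ->
  (forall w, 0 <= z w <= 1) -> 0 <= G z v <= 1.
Proof.
move=> alpha0 lambda0 z01.
have S0 : 0 <= \sum_(w \in [set: comb]) rate alpha v w * (1 - z w).
  apply: fsumr_ge0 => -[x1 y1] _; apply: mulr_ge0; last first.
    by have := z01 (x1, y1); lra.
  by case: v => x y; rewrite /rate; repeat case: ifP => _ //; lra.
have D1 := ler_wpDr (mulr_ge0 lambda0 S0) (lexx 1).
rewrite /offspring_gf invr_ge0 (le_trans ler01) //=.
by rewrite invf_le1 // (lt_le_trans ltr01).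
Qed.

Lemma offspring_gf_line z x y : G z (x, y.+1) =
  (1 + lambda * ((1 - z (x, y)) + (alpha + 1) * (1 - z (x, y.+2))))^-1.
Proof.
rewrite /offspring_gf (fsbigTE [fset (x, y); (x, y.+2)]%fset) /=; last first.
  move=> [x1 y1]; rewrite !inE !xpair_eqE [x1 == x]eq_sym.
  case: (eqVneq x x1) => [_|_] /=; last by rewrite mul0r.
  move=> /norP[/negbTE n1 /negbTE n2].
  by rewrite eqSS [y == y1]eq_sym n1 n2 mul0r.
rewrite big_fsetU1 /=; last first.
  by rewrite inE xpair_eqE eqxx -addn2 -{1}[y]addn0 eqn_add2l.
rewrite big_seq_fset1 !eqxx /= (_ : (y == y.+2) = false) ?mul1r //.
by rewrite -addn2 -{1}[y]addn0 eqn_add2l.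
Qed.

Hypothesis alpha_ge1 : 1 <= alpha.
Hypothesis lambdaP : lambda_w alpha < lambda <= lambda_s alpha.

(** The minimizer of s |-> 1 / s + (alpha + 1) s on the positive reals. *)
Definition decay : R := (Num.sqrt (alpha + 1))^-1.
Local Notation s := decay.

Let a1_gt1 : 1 < alpha + 1. Proof. by rewrite ltrDr (lt_le_trans ltr01). Qed.

Lemma decay_gt0 : 0 < s.
Proof. by rewrite invr_gt0 sqrtr_gt0 (lt_trans ltr01). Qed.

Lemma decay_lt1 : s < 1.
Proof.
rewrite invf_lt1 ?sqrtr_gt0 ?(lt_trans ltr01) // -[ltLHS]sqrtr1.
by rewrite ltr_sqrt // (lt_trans ltr01).
Qed.

Lemma decay_sq : (alpha + 1) * s ^+ 2 = 1.
Proof.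
rewrite exprVn sqr_sqrtr ?mulfV ?gt_eqF //; last first.
  by rewrite ltW // (lt_trans ltr01).
exact: lt_trans a1_gt1.
Qed.

Lemma lambda_gt0 : 0 < lambda.
Proof.
have /andP[+ _] := lambdaP; apply: le_lt_trans.
by rewrite /lambda_w divr_ge0 //; have := alpha_ge1; lra.
Qed.

Lemma growth_gt1 : 1 < lambda * (alpha + 2).
Proof.
have /andP[+ _] := lambdaP; rewrite /lambda_w ltr_pdivrMr //.
by have := alpha_ge1; lra.
Qed.

(** After division by s ^ y.+1 this reads 2 lambda sqrt (alpha + 1) <= 1, that
   is, lambda <= lambda_s. *)
Lemma decay_supersolution y :
  lambda * (s ^+ y + (alpha + 1) * s ^+ y.+2) <= s ^+ y.+1.
Proof.
have -> : (alpha + 1) * s ^+ y.+2 = s ^+ y.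
  by rewrite -[y.+2]addn2 exprD mulrCA decay_sq mulr1.
have /andP[_] := lambdaP.
rewrite /lambda_s div1r invfM -/s => lam.
have : lambda * 2 <= s by lra.
have : 0 <= s ^+ y by rewrite exprn_ge0 // ltW // decay_gt0.
by rewrite exprS; move: (s ^+ y) => p p0 h; nra.
Qed.

Lemma decay_pow01 y : 0 < s ^+ y <= 1.
Proof.
by rewrite exprn_gt0 ?decay_gt0 //= exprn_ile1 // ?ltW ?decay_gt0 ?decay_lt1.
Qed.

Variable j : int.

(** The mean number of particles that hit the base of the tooth j for the first
   time, for a walk started on that tooth at the local critical value of
   lambda. *)
Definition exit_bound (v : comb) : R := if v.1 == j then s ^+ v.2 else 1.

Lemma exit_bound01 v : 0 <= exit_bound v <= 1.
Proof.
rewrite /exit_bound; case: ifP => _; last by rewrite ler01 lexx.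
by have /andP[/ltW -> ->] := decay_pow01 v.2.
Qed.

(** Off the base the claim follows from superharmonicity and
   1 / (1 + t) >= 1 - t; elsewhere 1 - exit_bound vanishes. *)
Lemma exit_bound_gf v : 1 - exit_bound v <= G (fun u => 1 - exit_bound u) v.
Proof.
have f01 u : 0 <= 1 - exit_bound u <= 1 by have := exit_bound01 u; lra.
have [G0 _] := andP (offspring_gf_bounds v (le_trans ler01 alpha_ge1)
                       (ltW lambda_gt0) f01).
case: v G0 => x [|y] G0; rewrite {1}/exit_bound /=.
  by rewrite expr0 if_same subrr.
case: eqP => [->|_]; last by rewrite subrr.
rewrite offspring_gf_line /exit_bound /= !eqxx !subKr.
have := decay_supersolution y; have /andP[t0 t1] := decay_pow01 y.+1.
set L := lambda * _ => Lt.
have L0 : 0 <= L.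
  rewrite mulr_ge0 ?ltW ?lambda_gt0 // addr_gt0 ?mulr_gt0 //.
  - by have /andP[] := decay_pow01 y.
  - exact: lt_trans a1_gt1.
  - exact: decay_gt0.
rewrite -[leRHS]div1r ler_pdivlMr; last by lra.
nra.
Qed.

(** With m = lambda (alpha + 2), the positive root c of 1 + m c = 1 / (1 - c):
   the survival probability of the branching process with geometric offspring of
   mean m, which counts the particles of a walk on a line without base. *)
Definition growth_bound : R := 1 - (lambda * (alpha + 2))^-1.
Local Notation c := growth_bound.

Lemma growth_bound01 : 0 < c < 1.
Proof.
rewrite /c subr_gt0 invf_lt1 ?growth_gt1 ?(lt_trans ltr01 growth_gt1) //=.
by rewrite ltrBlDr ltrDl invr_gt0 (lt_trans ltr01 growth_gt1).
Qed.

(** The survival probability far from the base, corrected so as to vanish at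
   the base, where the walk may leave the tooth. *)
Definition stay_bound (v : comb) : R :=
  if v.1 == j then c * (1 - s ^+ v.2) else 0.

Lemma stay_bound01 v : 0 <= stay_bound v <= 1.
Proof.
rewrite /stay_bound; case: ifP => _; last by rewrite ler01 lexx.
have := decay_pow01 v.2; have := growth_bound01.
set t := s ^+ _ => c01 t01; nra.
Qed.

(** With t = s ^ y.+1, superharmonicity reduces the claim to
   (1 + c (m - t)) (1 - c (1 - t)) >= 1, which holds because c m = m - 1 and
   (m - t) (1 - t) <= m. *)
Lemma stay_bound_gf v :
  0 <= G (fun u => 1 - stay_bound u) v <= 1 - stay_bound v.
Proof.
have h01 u : 0 <= 1 - stay_bound u <= 1 by have := stay_bound01 u; lra.
have [G0 G1] := andP (offspring_gf_bounds v (le_trans ler01 alpha_ge1)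
                        (ltW lambda_gt0) h01).
rewrite G0 /=; case: v G0 G1 => x [|y] G0 G1; rewrite {2}/stay_bound /=.
  by rewrite expr0 subrr mulr0 if_same subr0.
case: eqP => [xj|_]; last by rewrite subr0.
rewrite xj offspring_gf_line /stay_bound /= !eqxx !subKr.
have := decay_supersolution y; have := decay_pow01 y.+1.
have := growth_bound01; have m1 := growth_gt1.
have cm : c * (lambda * (alpha + 2)) = lambda * (alpha + 2) - 1.
  by rewrite mulrBl mul1r mulVf // gt_eqF // (lt_trans ltr01).
set m := lambda * (alpha + 2) in m1 cm *.
set t := s ^+ y.+1; set p := s ^+ y; set q := s ^+ y.+2 => c01 t01 Lt.
have -> : lambda * (c * (1 - p) + (alpha + 1) * (c * (1 - q))) =
   c * (m - lambda * (p + (alpha + 1) * q)) by rewrite /m; ring.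
set L := lambda * (_ + _) in Lt *.
have cmt : c * (m - t) <= c * (m - L) by rewrite ler_pM2l; lra.
have key : 1 <= (1 + c * (m - t)) * (1 - c * (1 - t)).
  have -> : (1 + c * (m - t)) * (1 - c * (1 - t)) =
    1 + c * ((m - 1) - c * (m - t) * (1 - t)) by ring.
  rewrite lerDl mulr_ge0 //; first by lra.
  rewrite -cm; have : (m - t) * (1 - t) <= m by nra.
  move=> h; rewrite subr_ge0 -mulrA ler_pM2l //; lra.
have ct1 : 0 < 1 - c * (1 - t) by nra.
have cmt0 : 0 <= c * (m - t) by apply: mulr_ge0; lra.
rewrite -[leLHS]div1r ler_pdivrMr; last by lra.
rewrite mulrC; apply: le_trans key _.
by rewrite ler_pM2r //; lra.
Qed.

Lemma exit_lt_stay : exists y, exit_bound (j, y) < stay_bound (j, y).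
Proof.
rewrite /exit_bound /stay_bound /= eqxx.
have c01 := growth_bound01.
have : s ^+ y @[y --> \oo] --> (0 : R).
  by apply: cvg_expr; rewrite gtr0_norm ?decay_lt1 ?decay_gt0.
(* s ^ y < c / 2 < 1 / 2 gives c (1 - s ^ y) > c / 2. *)
move=> /cvgrPdist_lt/(_ (c / 2)) [|y _ /(_ y (leqnn y))]; first by lra.
rewrite /= sub0r normrN gtr0_norm ?exprn_gt0 ?decay_gt0 // => h.
by exists y; set t := s ^+ y in h *; nra.
Qed.

End CombEstimates.

(** * Comparison of extinction probabilities *)

(** Started high up on the tooth j, the walk is unlikely ever to leave it, hence
   to reach the teeth of I2, while its probability of surviving on the tooth j
   stays bounded away from 0. *)
Lemma extinction_prob_lt (R : realType) (alpha lambda : R)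
    (d : measure_display) (Omega : measurableType d)
    (P : probability Omega R)
    (xi : nat * comb * nat -> Omega -> config) (I1 I2 : set nat) (j : nat) :
  1 <= alpha -> lambda_w alpha < lambda <= lambda_s alpha ->
  offspring_family alpha lambda P xi ->
  I1 j -> ~ I2 j ->
  exists v, extinction_prob P xi (\bigcup_(i in I1) vertical_line i%:Z) v <
            extinction_prob P xi (\bigcup_(i in I2) vertical_line i%:Z) v.
Proof.
move=> alpha1 lam xiP I1j I2j.
have [y fh] := exit_lt_stay alpha1 lam j%:Z.
exists (j%:Z, y); rewrite /extinction_prob ltrD2l ltrN2.
have mS A := measurable_survival (j%:Z, y) xiP A.
rewrite -lte_fin !fineK ?fin_num_measure //.
apply: (@le_lt_trans _ _ (exit_bound alpha j%:Z (j%:Z, y))%:E).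
  apply: (survival_le _ xiP); first exact: exit_bound01 alpha1 _.
    move=> [x z] [i I2i /= xi_]; rewrite /exit_bound /=; case: eqP => // xj.
    by case: I2j; have [<-] : i%:Z = j%:Z by rewrite -xi_.
  exact: exit_bound_gf alpha1 lam _.
apply: (@lt_le_trans _ _ (stay_bound alpha lambda j%:Z (j%:Z, y))%:E).
  by rewrite lte_fin.
apply: (survival_ge _ xiP).
- exact: stay_bound01 alpha1 lam _.
- move=> [x z] nx; rewrite /stay_bound /=; case: eqP => // xj.
  by case: nx; exists j.
- exact: stay_bound_gf alpha1 lam _.
Qed.

Theorem theorem3p6 (R : realType) (alpha lambda : R)
    (d : measure_display) (Omega : measurableType d)
    (P : probability Omega R)
    (xi : nat * comb * nat -> Omega -> config)
    (I1 I2 : set nat) :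
  1 <= alpha ->
  lambda_w alpha < lambda <= lambda_s alpha ->
  offspring_family alpha lambda P xi ->
  I1 `<=` [set: nat] `\ 0%N ->
  I2 `<=` [set: nat] `\ 0%N ->
  (\esum_(i in I1) (2 ^- i : R)%:E <> \esum_(i in I2) (2 ^- i : R)%:E)%E ->
  extinction_prob P xi (\bigcup_(i in I1) vertical_line i%:Z) <>
  extinction_prob P xi (\bigcup_(i in I2) vertical_line i%:Z).
Proof.
move=> alpha1 lam xiP _ _ I12 qE; apply: I12; congr esum.
apply/seteqP; split=> j Ij; apply: contrapT => nIj;
by have [v] := extinction_prob_lt alpha1 lam xiP Ij nIj; rewrite qE ltxx.
Qed.
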